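(* Let $n, a, b$ be positive integers with $\gcd(a,b)=1$. Then $n!$ divides $\prod_{i=1}^{n}(a+bi)$ if and only if $\gcd(n!,b)=1$. *)

(* Defs.v *)
From mathcomp Require Export all_boot.

(* Main.v *)
Require Import Defs.
From mathcomp Require Import all_boot.

(** Each term [a + b * i] is congruent to [a] modulo [b], hence coprime to [b],
    and so is their product; a divisor [n`!] of that product is therefore
    coprime to [b].

    Conversely, if [n`!] is coprime to [b], then [b] is invertible modulo [n`!],
    so [a] is congruent to [b * c] for some [c], and the product is congruent
    modulo [n`!] to [b ^ n] times [(c + 1) * ... * (c + n)]. A product of [n]
    consecutive integers is a multiple of [n`!], the quotient being a binomial
    coefficient ([dvdn_fact_prod_consecutive]). *)

Lemma prod_consecutive_fact c n :
  (\prod_(1 <= i < n.+1) (c + i)) * c`! = (c + n)`!.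
Proof.
elim: n => [|n IHn]; first by rewrite big_geq // mul1n addn0.
by rewrite big_nat_recr //= mulnAC IHn mulnC addnS factS.
Qed.

Lemma dvdn_fact_prod_consecutive c n :
  n`! %| \prod_(1 <= i < n.+1) (c + i).
Proof.
apply/dvdnP; exists 'C(c + n, n).
apply/eqP; rewrite -(eqn_pmul2r (fact_gt0 c)) prod_consecutive_fact -mulnA.
by have := bin_fact (leq_addl c n); rewrite addnK => ->.
Qed.

Lemma eqn_mod_prod (I : Type) (r : seq I) (F G : I -> nat) m :
  (forall i, F i = G i %[mod m]) ->
  \prod_(i <- r) F i = \prod_(i <- r) G i %[mod m].
Proof.
move=> eqFG; elim/big_rec2: _ => // i x y _ eqxy.
by rewrite -modnMm eqFG eqxy modnMm.
Qed.

Lemma coprime_prod_arith a b n :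
  coprime a b -> coprime (\prod_(1 <= i < n.+1) (a + b * i)) b.
Proof.
move=> co_ab; elim/big_ind: _ => [|x y cox coy|i _]; first exact: coprime1n.
  by rewrite coprimeMl cox.
by rewrite /coprime gcdnC mulnC addnC gcdnMDl gcdnC.
Qed.

(** The witness is [x %/ b], where the Chinese remainder theorem supplies [x]
    congruent to [a] modulo [m] and to [0] modulo [b]. *)
Lemma coprime_solve_mod m b a :
  coprime m b -> exists c, a = b * c %[mod m].
Proof.
move=> co_mb; have b_dvd : b %| chinese m b a 0.
  by rewrite /dvdn (chinese_modr co_mb) mod0n.
exists (chinese m b a 0 %/ b).
by rewrite mulnC divnK // (chinese_modl co_mb).
Qed.

Theorem theorem1 (n a b : nat) (n_gt0 : 0 < n) (a_gt0 : 0 < a) (b_gt0 : 0 < b)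
    (gcd_ab : gcdn a b = 1) :
  n`! %| \prod_(1 <= i < n.+1) (a + b * i) <-> gcdn n`! b = 1.
Proof.
split=> [dvd_prod | /eqP co_nb].
  apply/eqP/(coprime_dvdl dvd_prod)/coprime_prod_arith.
  exact/eqP.
have [c eq_a] := coprime_solve_mod n`! b a co_nb.
have eq_term i : a + b * i = b * (c + i) %[mod n`!].
  by rewrite mulnDr -modnDml eq_a modnDml.
rewrite /dvdn (eqn_mod_prod _ _ _ _ _ eq_term) -/(dvdn _ _) big_split /=.
exact/dvdn_mull/dvdn_fact_prod_consecutive.
Qed.
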